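(* Let $n,r,s$ be positive integers. Let $W_n$ and $Z_n$ be the Horadam quaternions built from the Horadam sequences $w_n=w_n(w_0,w_1;p,q)$ and $z_n=w_n(z_0,z_1;p,q)$ respectively. Then $$Z_{n+r}W_{n+s}-Z_nW_{n+r+s}=(-q)^n u_r\left(Z_1W_s-Z_0W_{s+1}\right).$$
   Context: Let $H$ be the real quaternion algebra with basis $1,i,j,k$ and (non-commutative) multiplication determined by $i^2=j^2=k^2=-1$, $ij=-ji=k$, $jk=-kj=i$, $ki=-ik=j$; real scalars commute with all quaternions. Fix real numbers $p,q$. For real $a,b$, the Horadam sequence $w_n(a,b;p,q)$ is defined by $w_0=a$, $w_1=b$, $w_n=pw_{n-1}+qw_{n-2}$ for $n\ge 2$. Let $u_n=w_n(0,1;p,q)$ (the $(p,q)$-Fibonacci numbers). For a Horadam sequence $(x_n)$ the associated Horadam quaternions are $X_n=x_n+x_{n+1}i+x_{n+2}j+x_{n+3}k$; thus $W_n=w_n+w_{n+1}i+w_{n+2}j+w_{n+3}k$ and $Z_n=z_n+z_{n+1}i+z_{n+2}j+z_{n+3}k$. *)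

(* Defs.v *)
From HB Require Import structures.
From mathcomp Require Import all_boot all_order all_algebra.
From mathcomp Require Import reals.
From mathcomp Require Import ring.

Set Implicit Arguments.
Unset Strict Implicit.
Unset Printing Implicit Defensive.

Import Order.TTheory GRing.Theory Num.Theory.

Local Open Scope ring_scope.

(* [Quat a b c d] stands for a + b i + c j + d k; see [quatE]. *)
Record quat (R : Type) : Type := Quat { qre : R; qim : R; qjm : R; qkm : R }.

Section QuatCan.
Variable R : Type.

Definition tuple_of_quat (x : quat R) : R * R * R * R :=
  (qre x, qim x, qjm x, qkm x).
Definition quat_of_tuple (t : R * R * R * R) : quat R :=
  let: (a, b, c, d) := t in Quat a b c d.

Lemma tuple_of_quatK : cancel tuple_of_quat quat_of_tuple.
Proof. by case. Qed.

End QuatCan.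

HB.instance Definition _ (R : eqType) :=
  Equality.copy (quat R) (can_type (@tuple_of_quatK R)).
HB.instance Definition _ (R : choiceType) :=
  Choice.copy (quat R) (can_type (@tuple_of_quatK R)).

Section QuatAlgebra.
Variable R : comNzRingType.
Implicit Types (x y z : quat R) (a b : R).

Definition addq x y : quat R :=
  Quat (qre x + qre y) (qim x + qim y) (qjm x + qjm y) (qkm x + qkm y).
Definition oppq x : quat R := Quat (- qre x) (- qim x) (- qjm x) (- qkm x).
Definition zeroq : quat R := Quat 0 0 0 0.

Fact addqA : associative addq.
Proof. by move=> x y z; rewrite /addq /= !addrA. Qed.
Fact addqC : commutative addq.
Proof. by move=> x y; congr Quat; rewrite /= addrC. Qed.
Fact add0q : left_id zeroq addq.
Proof. by case=> a b c d; rewrite /addq /= !add0r. Qed.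
Fact addNq : left_inverse zeroq oppq addq.
Proof. by move=> x; rewrite /addq /= !addNr. Qed.

HB.instance Definition _ :=
  GRing.isZmodule.Build (quat R) addqA addqC add0q addNq.

Definition oneq : quat R := Quat 1 0 0 0.
(* Bilinear extension of i^2 = j^2 = k^2 = -1, ij = -ji = k, jk = -kj = i,
   ki = -ik = j; these identities are proved below. *)
Definition mulq x y : quat R :=
  Quat (qre x * qre y - qim x * qim y - qjm x * qjm y - qkm x * qkm y)
       (qre x * qim y + qim x * qre y + qjm x * qkm y - qkm x * qjm y)
       (qre x * qjm y - qim x * qkm y + qjm x * qre y + qkm x * qim y)
       (qre x * qkm y + qim x * qjm y - qjm x * qim y + qkm x * qre y).

Fact mulqA : associative mulq.
Proof. by move=> x y z; congr Quat; rewrite /=; ring. Qed.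
Fact mul1q : left_id oneq mulq.
Proof. by case=> a b c d; congr Quat; rewrite /=; ring. Qed.
Fact mulq1 : right_id oneq mulq.
Proof. by case=> a b c d; congr Quat; rewrite /=; ring. Qed.
Fact mulqDl : left_distributive mulq addq.
Proof. by move=> x y z; congr Quat; rewrite /=; ring. Qed.
Fact mulqDr : right_distributive mulq addq.
Proof. by move=> x y z; congr Quat; rewrite /=; ring. Qed.
Fact oneq_neq0 : oneq != 0.
Proof. by apply/eqP => -[] /eqP; rewrite oner_eq0. Qed.

HB.instance Definition _ := GRing.Zmodule_isNzRing.Build (quat R)
  mulqA mul1q mulq1 mulqDl mulqDr oneq_neq0.

Definition scaleq a x : quat R :=
  Quat (a * qre x) (a * qim x) (a * qjm x) (a * qkm x).

Fact scaleqA a b x : scaleq a (scaleq b x) = scaleq (a * b) x.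
Proof. by rewrite /scaleq /= !mulrA. Qed.
Fact scale1q : left_id 1 scaleq.
Proof. by case=> a b c d; rewrite /scaleq /= !mul1r. Qed.
Fact scaleqDr : right_distributive scaleq +%R.
Proof. by move=> a x y; rewrite /scaleq /= !mulrDr. Qed.
Fact scaleqDl x : {morph scaleq^~ x : a b / a + b}.
Proof. by move=> a b; rewrite /scaleq !mulrDl. Qed.

HB.instance Definition _ := GRing.Zmodule_isLmodule.Build R (quat R)
  scaleqA scale1q scaleqDr scaleqDl.

Fact scaleqAl a x y : a *: (x * y) = (a *: x) * y.
Proof. by congr Quat; rewrite /=; ring. Qed.
HB.instance Definition _ := GRing.Lmodule_isLalgebra.Build R (quat R) scaleqAl.

Fact scaleqAr a x y : a *: (x * y) = x * (a *: y).
Proof. by congr Quat; rewrite /=; ring. Qed.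
HB.instance Definition _ := GRing.Lalgebra_isAlgebra.Build R (quat R) scaleqAr.

Definition qi : quat R := Quat 0 1 0 0.
Definition qj : quat R := Quat 0 0 1 0.
Definition qk : quat R := Quat 0 0 0 1.

Lemma quatE a b c d : Quat a b c d = a%:A + b *: qi + c *: qj + d *: qk.
Proof. by congr Quat; rewrite /=; ring. Qed.

Lemma qii : qi * qi = -1. Proof. by congr Quat; rewrite /=; ring. Qed.
Lemma qjj : qj * qj = -1. Proof. by congr Quat; rewrite /=; ring. Qed.
Lemma qkk : qk * qk = -1. Proof. by congr Quat; rewrite /=; ring. Qed.
Lemma qij : qi * qj = qk. Proof. by congr Quat; rewrite /=; ring. Qed.
Lemma qji : qj * qi = - qk. Proof. by congr Quat; rewrite /=; ring. Qed.
Lemma qjk : qj * qk = qi. Proof. by congr Quat; rewrite /=; ring. Qed.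
Lemma qkj : qk * qj = - qi. Proof. by congr Quat; rewrite /=; ring. Qed.
Lemma qki : qk * qi = qj. Proof. by congr Quat; rewrite /=; ring. Qed.
Lemma qik : qi * qk = - qj. Proof. by congr Quat; rewrite /=; ring. Qed.

End QuatAlgebra.

Arguments qi {R}.
Arguments qj {R}.
Arguments qk {R}.

Fixpoint horadam (R : comNzRingType) (a b p q : R) (n : nat) : R :=
  match n with
  | 0 => a
  | n1.+1 =>
      match n1 with
      | 0 => b
      | n2.+1 => p * horadam a b p q n1 + q * horadam a b p q n2
      end
  end.

Definition pqfib (R : comNzRingType) (p q : R) : nat -> R := horadam 0 1 p q.

Definition seq_quat (R : comNzRingType) (x : nat -> R) (n : nat) : quat R :=
  (x n)%:A + x (n + 1)%N *: qi + x (n + 2)%N *: qj + x (n + 3)%N *: qk.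

Definition horadam_quat (R : comNzRingType) (a b p q : R) : nat -> quat R :=
  seq_quat (horadam a b p q).

(* Main.v *)
Require Import Defs.
From HB Require Import structures.
From mathcomp Require Import all_boot all_order all_algebra.
From mathcomp Require Import reals.

Import Order.TTheory GRing.Theory Num.Theory.

Local Open Scope ring_scope.

(** For fixed [n] and [s], the left-hand side is, as a sequence in [r], a
    solution of the Horadam recurrence vanishing at [r = 0]; hence it is [u_r]
    times its value at [r = 1].  That value, [Z_(n+1) W_(n+s) - Z_n W_(n+s+1)],
    is multiplied by [- q] when [n] increases by one, because the [p]-terms
    cancel.  Only the recurrence and the bilinearity of the product are used,
    so commutativity plays no role. *)

Definition horadam_rec {R : pzRingType} {V : lmodType R} (p q : R)
    (X : nat -> V) : Prop :=
  forall n, X n.+2 = p *: X n.+1 + q *: X n.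

Lemma horadam_rec_pqfib (R : comNzRingType) (V : lmodType R) (p q : R)
    (X : nat -> V) :
  horadam_rec p q X -> X 0%N = 0 -> forall r, X r = pqfib p q r *: X 1%N.
Proof.
move=> recX X0 r.
(* The recurrence has order two, so the induction carries two consecutive values. *)
suff [] : X r = pqfib p q r *: X 1%N /\ X r.+1 = pqfib p q r.+1 *: X 1%N by [].
elim: r => [|r [IH0 IH1]]; first by rewrite X0 scale0r scale1r.
by split=> //; rewrite recX IH0 IH1 !scalerA -scalerDl.
Qed.

Lemma horadam_rec_cross (R : comNzRingType) (A : algType R) (p q : R)
    (Z W : nat -> A) :
  horadam_rec p q Z -> horadam_rec p q W -> forall n s,
  Z n.+1 * W (n + s)%N - Z n * W (n + s).+1
  = (- q) ^+ n *: (Z 1%N * W s - Z 0%N * W s.+1).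
Proof.
move=> recZ recW n s; elim: n => [|n IH]; first by rewrite expr0 scale1r.
rewrite exprS -scalerA -IH addSn recZ recW mulrDl mulrDr -!scalerAl -!scalerAr.
(* Both expansions produce [p *: (Z n.+1 * W (n + s).+1)]; [addrAC] makes the two copies adjacent so
   that they cancel. *)
by rewrite opprD addrA [X in X - _ = _]addrAC subrr add0r scaleNr scalerBr opprB.
Qed.

Lemma horadam_rec_vajda (R : comNzRingType) (A : algType R) (p q : R)
    (Z W : nat -> A) :
  horadam_rec p q Z -> horadam_rec p q W -> forall n r s,
  Z (n + r)%N * W (n + s)%N - Z n * W (n + r + s)%N
  = ((- q) ^+ n * pqfib p q r) *: (Z 1%N * W s - Z 0%N * W s.+1).
Proof.
move=> recZ recW n r s.
pose X k := Z (n + k)%N * W (n + s)%N - Z n * W (n + k + s)%N.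
have recX : horadam_rec p q X.
  (* Each product has one factor independent of [k], so [X] inherits the recurrence. *)
  move=> k; rewrite /X !addnS !addSn recZ recW mulrDl mulrDr.
  by rewrite -!scalerAl -!scalerAr opprD addrACA -!scalerBr.
have X0 : X 0%N = 0 by rewrite /X addn0 subrr.
rewrite -/(X r) (horadam_rec_pqfib _ _ _ _ _ recX X0) /X addn1 addSn.
by rewrite (horadam_rec_cross _ _ _ _ _ _ recZ recW) scalerA mulrC.
Qed.

Lemma horadam_quat_rec (R : comNzRingType) (a b p q : R) :
  horadam_rec p q (horadam_quat a b p q).
Proof.
(* In coordinates, with indices shaped as [(n + i).+2], each equation holds by unfolding
   [horadam]. *)
move=> n; rewrite /horadam_quat /seq_quat -!quatE !addSn.
by congr Quat.
Qed.

Theorem theorem2p3 (R : realType) (p q w0 w1 z0 z1 : R) (n r s : nat)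
    (hn : (0 < n)%N) (hr : (0 < r)%N) (hs : (0 < s)%N) :
  let W := horadam_quat w0 w1 p q in
  let Z := horadam_quat z0 z1 p q in
  Z (n + r)%N * W (n + s)%N - Z n * W (n + r + s)%N
  = ((- q) ^+ n * pqfib p q r) *: (Z 1%N * W s - Z 0%N * W (s + 1)%N).
Proof.
by move=> W Z; rewrite addn1; apply: horadam_rec_vajda; apply: horadam_quat_rec.
Qed.
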